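(* Let $A_1,A_2$ be two non-singular real symmetric $n\times n$ matrices. Assume that $A_1^{-1}A_2$ is diagonalizable over $\mathbb C$. Then there exists a non-singular real matrix $P$ such that $$P^tA_1P=\mathrm{diag}(C_1,\dots,C_m),\qquad P^tA_2P=\mathrm{diag}(D_1,\dots,D_m)$$ (block diagonal matrices) for some integer $m$ satisfying $1\le m\le n$, where each pair $(C_i,D_i)$, $i=1,\dots,m$, is either of Type I or of Standard Type II.
   Context: A pair of real numbers $(C,D)$ is of Type I if both $C$ and $D$ are non-zero. A pair of real $2\times2$ matrices $(C,D)$ is of Type II if $$C=\begin{pmatrix}\alpha_1&\beta_1\\ \beta_1&-\alpha_1\end{pmatrix},\qquad D=\begin{pmatrix}\alpha_2&\beta_2\\ \beta_2&-\alpha_2\end{pmatrix},\qquad \alpha_2\beta_1-\alpha_1\beta_2>0,$$ and of Standard Type II if moreover $\alpha_2\beta_1-\alpha_1\beta_2=1$. *)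

(* Defs.v *)
From HB Require Import structures.
From mathcomp Require Import all_boot all_order all_algebra.
From mathcomp Require Import complex.
From mathcomp Require Import reals.

Set Implicit Arguments.
Unset Strict Implicit.
Unset Printing Implicit Defensive.

Import Order.TTheory GRing.Theory Num.Theory.
Local Open Scope ring_scope.

Definition typeI (R : realType) (c d : R) : Prop := c != 0 /\ d != 0.

(* The real symmetric trace-free 2 x 2 matrix
     /  a   b \
     \  b  -a /   *)
Definition sym_traceless (R : realType) (a b : R) : 'M[R]_2 :=
  \matrix_(i, j) if i == j then (if i == 0 then a else - a) else b.

Definition typeII_with (R : realType) (a1 b1 a2 b2 : R) (C D : 'M[R]_2) : Prop :=
  [/\ C = sym_traceless a1 b1, D = sym_traceless a2 b2 & 0 < a2 * b1 - a1 * b2].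

Definition typeII (R : realType) (C D : 'M[R]_2) : Prop :=
  exists a1 b1 a2 b2 : R, typeII_with a1 b1 a2 b2 C D.

Definition standard_typeII (R : realType) (C D : 'M[R]_2) : Prop :=
  exists a1 b1 a2 b2 : R,
    typeII_with a1 b1 a2 b2 C D /\ a2 * b1 - a1 * b2 = 1.

(* The index k is the common size of the two blocks; the real numbers of a
   Type I pair are viewed as 1 x 1 matrices. *)
Inductive typeI_or_standard_typeII (R : realType) :
    forall k : nat, 'M[R]_k -> 'M[R]_k -> Prop :=
| Block_typeI (c d : R) :
    typeI c d -> @typeI_or_standard_typeII R 1 c%:M d%:M
| Block_standard_typeII (C D : 'M[R]_2) :
    standard_typeII C D -> @typeI_or_standard_typeII R 2 C D.

(* Main.v *)
(** The operator S = A2 A1^-1, acting on row vectors, is self-adjoint for A1,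
    and an eigenspace is anisotropic somewhere: if an eigenvector x were
    A1-orthogonal to its whole eigenspace, it would lie in the image of S - a,
    giving a Jordan chain.  A real anisotropic eigenvector spans a Type I block.
    For a non-real eigenvalue, let z = u + i v be anisotropic; as z and its
    conjugate are orthogonal, A1(u, u) = - A1(v, v), so both forms are
    trace-free on span(u, v), and a scaling of u and v (with a possible sign
    change of v) makes the pair Standard Type II.  The A1-orthogonal complement
    of the block is S-invariant and non-degenerate, and inherits the absence of
    Jordan chains, so one concludes by induction on the dimension. *)
Require Import Defs.
From HB Require Import structures.
From mathcomp Require Import all_boot all_order all_algebra.
From mathcomp Require Import complex.
From mathcomp Require Import reals.
From mathcomp Require Import ring lra.

Set Implicit Arguments.
Unset Strict Implicit.
Unset Printing Implicit Defensive.

Import Order.TTheory GRing.Theory Num.Theory.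
Local Open Scope ring_scope.

(** * Absence of Jordan chains *)

(** Unlike diagonalizability, this condition passes to invariant subspaces and to subfields by
    direct substitution, as the induction requires. *)
Definition no_jordan_chain (F : fieldType) n (S : 'M[F]_n) : Prop :=
  forall (a : F) (x y : 'rV_n), x *m S = a *: x -> y *m S = a *: y + x -> x = 0.

(** In eigenbasis coordinates the chain reads [(D_j - a) x_j = 0] and [(D_j - a) y_j = x_j]; whether
    or not [D_j = a], this forces [x_j = 0]. *)
Lemma diagonalizable_no_jordan_chain_tr (F : fieldType) n (S : 'M[F]_n) :
  diagonalizable S -> no_jordan_chain S^T.
Proof.
move=> [P Pu /(diagonalizable_forLR Pu)[D SE]] a x y xS yS.
have SP : S^T *m P^T = P^T *m diag_mx D.
  rewrite -!trmx_mul SE mxpoly.conjVmx // !mulmxA mulmxV // mul1mx.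
  by rewrite trmx_mul tr_diag_mx.
have PTu : P^T \in unitmx by rewrite unitmx_tr.
apply: (can_inj (mulmxK PTu)); rewrite mul0mx.
move/(congr1 (mulmx^~ P^T)): xS; move/(congr1 (mulmx^~ P^T)): yS.
rewrite mulmxDl -!scalemxAl -!mulmxA SP !mulmxA.
move: (x *m P^T) (y *m P^T) => {SP}x {}y yD xD.
apply/rowP=> j; have := congr1 (fun v : 'rV_n => v 0 j) yD.
have := congr1 (fun v : 'rV_n => v 0 j) xD.
rewrite /= !mul_mx_diag !mxE => xj yj.
have [Da|Da] := eqVneq (D 0 j) a.
  by apply: (@addrI _ (a * y 0 j)); rewrite -yj Da addr0 mulrC.
have /eqP : x 0 j * (D 0 j - a) = 0 by rewrite mulrBr xj mulrC subrr.
by rewrite mulf_eq0 subr_eq0 (negPf Da) orbF => /eqP.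
Qed.

Lemma no_jordan_chain_restrict (F : fieldType) k n (K : 'M[F]_(k, n))
    (S : 'M[F]_n) (T : 'M[F]_k) :
  row_free K -> K *m S = T *m K -> no_jordan_chain S -> no_jordan_chain T.
Proof.
move=> Kfree KS njS a x y xT yT; apply: (row_free_inj Kfree); rewrite mul0mx.
apply: (njS a _ (y *m K)); rewrite -mulmxA KS mulmxA ?xT;
  by rewrite ?yT ?mulmxDl -scalemxAl.
Qed.

Lemma no_jordan_chain_map (F F' : fieldType) (f : {rmorphism F -> F'}) n
    (S : 'M[F]_n) :
  no_jordan_chain (map_mx f S) -> no_jordan_chain S.
Proof.
move=> njS a x y xS yS; apply: (map_mx_inj (f := f)); rewrite map_mx0.
apply: (njS (f a) _ (map_mx f y)); rewrite -map_mxM ?xS ?yS ?map_mxD map_mxZ //.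
Qed.

(** * Anisotropic eigenvectors *)

(** The rows of [1 - M *m pinvmx M] lie in the left kernel of [M], which [C] annihilates. *)
Lemma kermx_mul0_factor (F : fieldType) m n p (M : 'M[F]_(m, n)) (C : 'M_(m, p)) :
  kermx M *m C = 0 -> exists W, C = M *m W.
Proof.
move=> kC; exists (pinvmx M *m C); rewrite mulmxA.
have /submxP[D DE] : (1%:M - M *m pinvmx M <= kermx M)%MS.
  by apply/sub_kermxP; rewrite mulmxBl mul1mx mulmxKpV ?subrr.
apply/eqP; rewrite -subr_eq0 -{1}[C]mul1mx -mulmxBl DE -mulmxA kC mulmx0.
by rewrite eqxx.
Qed.

Lemma anisotropic_eigenvector (F : fieldType) n (A S : 'M[F]_n) (a : F)
    (x : 'rV_n) :
    2%:R != 0 :> F -> A \in unitmx -> A^T = A -> (S *m A)^T = S *m A ->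
    no_jordan_chain S -> x *m S = a *: x -> x != 0 ->
  exists2 z : 'rV_n, z *m S = a *: z & z *m A *m z^T != 0.
Proof.
move=> F2 Au As SAs njS xS x0.
have [z zS zx] : exists2 z : 'rV_n, z *m S = a *: z & z *m A *m x^T != 0.
  have [/eqP k0|] := boolP (kermx (S - a%:M) *m (A *m x^T) == 0); last first.
    case/matrix0Pn => i [j]; rewrite (ord1 j) => kij.
    exists (row i (kermx (S - a%:M))).
      apply/eqP; rewrite -subr_eq0 -mul_mx_scalar -mulmxBr -row_mul mulmx_ker.
      by rewrite row0.
    apply: contraNneq kij => e; rewrite -mulmxA -row_mul in e.
    by have := congr1 (fun v : 'rV_1 => v 0 0) e; rewrite /= !mxE => ->.
  have [w Ax] := kermx_mul0_factor k0.
  have SAT : A *m S^T = S *m A by rewrite -SAs trmx_mul As.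
  (* Here [A x^T = (S - a) w]. Writing [w = A y^T] and using [S A = A S^T], cancelling [A] gives
     [x = y (S - a)]: a Jordan chain. *)
  pose y := w^T *m invmx A.
  have yA : A *m y^T = w by rewrite -[A in A *m _]As -trmx_mul mulmxKV ?trmxK.
  case/eqP: x0; apply: (njS a x y) => //.
  apply/eqP; rewrite addrC -subr_eq; apply/eqP/trmx_inj.
  apply: (can_inj (mulKmx Au)); rewrite Ax -yA linearB /= trmx_mul linearZ /=.
  rewrite mulmxBl mulmxBr !mulmxA SAT -scalemxAr mul_scalar_mx.
  by rewrite -scalemxAl.
have sym (u v : 'rV[F]_n) : u *m A *m v^T = v *m A *m u^T.
  have tr11 (M : 'M[F]_1) : M = M^T by apply/matrixP=> i j; rewrite mxE !ord1.
  by rewrite [LHS]tr11 !trmx_mul trmxK As mulmxA.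
have [zz|] := eqVneq (z *m A *m z^T) 0; last by exists z.
have [xx|] := eqVneq (x *m A *m x^T) 0; last by exists x.
(* Polarization: with [x] and [z] both isotropic, the form at [x + z] is twice its value at the pair
   [z], [x]. *)
exists (x + z); first by rewrite mulmxDl xS zS scalerDr.
rewrite linearD /= !mulmxDl !mulmxDr xx zz addr0 add0r (sym x z).
by rewrite -mulr2n -scaler_nat scaler_eq0 negb_or F2.
Qed.

(** * Real and imaginary parts *)

Lemma map_mx_complexE (R : realType) m n (z : 'M[R[i]]_(m, n)) :
  z = map_mx (real_complex R) (map_mx (@complex.Re R) z)
      + 'i%C *: map_mx (real_complex R) (map_mx (@complex.Im R) z).
Proof. by apply/matrixP=> i j; rewrite !mxE -complexE. Qed.

Lemma complex_eigenvectorP (R : realType) n (S : 'M[R]_n) (mu nu : R)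
    (z : 'rV[R[i]]_n)
    (u := map_mx (@complex.Re R) z) (v := map_mx (@complex.Im R) z) :
    z *m map_mx (real_complex R) S = Complex mu nu *: z ->
  u *m S = mu *: u - nu *: v /\ v *m S = nu *: u + mu *: v.
Proof.
rewrite {1}[z]map_mx_complexE mulmxDl -scalemxAl -!map_mxM -/u -/v => zS.
by split; apply/rowP=> j; have := congr1 (fun w : 'rV_n => w 0 j) zS;
  rewrite /u /v !mxE; case: (z 0 j) => a b /= /eqP; rewrite eq_complex /=;
  case/andP=> /eqP + /eqP; lra.
Qed.

(** The transpose is not conjugated: the form is bilinear, not Hermitian, hence the difference in
    the real part. *)
Lemma complex_formE (R : realType) n (A : 'M[R]_n) (z : 'rV[R[i]]_n)
   
    (u := map_mx (@complex.Re R) z) (v := map_mx (@complex.Im R) z) :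
    A^T = A ->
  (z *m map_mx (real_complex R) A *m z^T) 0 0 =
    Complex ((u *m A *m u^T) 0 0 - (v *m A *m v^T) 0 0)
            ((u *m A *m v^T) 0 0 *+ 2).
Proof.
move=> As; have vu : (v *m A *m u^T) 0 0 = (u *m A *m v^T) 0 0.
  transitivity ((v *m A *m u^T)^T 0 0); first by rewrite [RHS]mxE.
  by rewrite !trmx_mul trmxK As mulmxA.
rewrite [z]map_mx_complexE -/u -/v; clearbody u v.
rewrite linearD linearZ /= !mulmxDl !mulmxDr.
rewrite -!scalemxAr -!scalemxAl !map_trmx -!map_mxM.
move: vu; move: (u *m A *m u^T) (u *m A *m v^T) (v *m A *m u^T) (v *m A *m v^T).
move=> uu uv vu vv E; rewrite !mxE E; apply/eqP; rewrite eq_complex /=.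
by apply/andP; split; apply/eqP; ring.
Qed.

(** * Blocks spanned by eigenvectors *)

Lemma mulmx_congrE (R : comNzRingType) k n (Q : 'M[R]_(k, n)) (B : 'M_n) i j :
  (Q *m B *m Q^T) i j = (row i Q *m B *m (row j Q)^T) 0 0.
Proof. by rewrite -row_mul !mxE; apply: eq_bigr => l _; rewrite !mxE. Qed.

(** Scaling [u] by [t] and [v] by [e * t] multiplies [a2 * b1 - a1 * b2] by [t ^+ 4 * e]; these [t]
    and [e] bring the value [q] to 1. *)
Lemma signed_fourth_root_inv (R : rcfType) (q : R) :
  q != 0 -> exists t e : R, e ^+ 2 = 1 /\ t ^+ 4 * e * q = 1.
Proof.
move=> q0; exists (Num.sqrt (Num.sqrt `|q|^-1)), (Num.sg q); split.
  by rewrite sqr_sg q0.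
rewrite (exprM _ 2 2) !sqr_sqrtr ?sqrtr_ge0 ?invr_ge0 //.
by rewrite -mulrA -normrEsg mulVf ?normr_eq0.
Qed.

Lemma real_eigen_block (R : realType) n (A S : 'M[R]_n) (a : R) (z : 'rV_n) :
    S \in unitmx -> z *m S = a *: z -> z *m A *m z^T != 0 ->
  typeI_or_standard_typeII (z *m A *m z^T) (z *m (S *m A) *m z^T).
Proof.
move=> Su zS zz; have a0 : a != 0.
  apply: contraNneq zz => a0; move: zS; rewrite a0 scale0r.
  move/(congr1 (mulmx^~ (invmx S))).
  by rewrite mulmxK // mul0mx => ->; rewrite !mul0mx.
rewrite mulmxA zS -!scalemxAl; move: zz; rewrite [_ *m z^T]mx11_scalar.
move: (_ 0 0) => c; rewrite scale_scalar_mx => c0.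
have {}c0 : c != 0 by apply: contraNneq c0 => ->; rewrite raddf0.
by constructor; split=> //; rewrite mulf_neq0.
Qed.

Lemma complex_eigen_block (R : realType) n (A S : 'M[R]_n) (mu nu : R)
    (u v : 'rV_n) :
    A^T = A -> (S *m A)^T = S *m A -> nu != 0 ->
    u *m S = mu *: u - nu *: v -> v *m S = nu *: u + mu *: v ->
    ((u *m A *m u^T) 0 0 != (v *m A *m v^T) 0 0) ||
      ((u *m A *m v^T) 0 0 != 0) ->
  exists (Q : 'M_(2, n)) (M : 'M_2), Q *m S = M *m Q /\
    typeI_or_standard_typeII (Q *m A *m Q^T) (Q *m (S *m A) *m Q^T).
Proof.
move=> As SAs nu0 uS vS.
pose b (B : 'M[R]_n) (x y : 'rV[R]_n) := (x *m B *m y^T) 0 0.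
have bsym (B : 'M[R]_n) x y : B^T = B -> b B x y = b B y x.
  move=> Bs; transitivity ((x *m B *m y^T)^T 0 0); first by rewrite mxE.
  by rewrite !trmx_mul trmxK Bs mulmxA.
have buS y : b (S *m A) u y = mu * b A u y - nu * b A v y.
  by rewrite /b !mulmxA uS !mulmxBl -!scalemxAl !mxE.
have bvS y : b (S *m A) v y = nu * b A u y + mu * b A v y.
  by rewrite /b !mulmxA vS !mulmxDl -!scalemxAl !mxE.
(* Symmetry of [S *m A] at [u], [v] reads [- nu * c = nu * a]. *)
have := bsym _ u v SAs; rewrite buS bvS (bsym A v u) //.
set a := b A u u; set c := b A v v; set d := b A u v => ac.
have {}ac : c = - a.
  by apply: (mulfI nu0); move: ac; lra.
rewrite -/(b A u u) -/(b A v v) -/(b A u v) -/a -/c -/d ac => ad.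
(* This is the value of [a2 * b1 - a1 * b2] for the unscaled basis [u], [v]. *)
have q0 : - nu * (d ^+ 2 + a ^+ 2) != 0.
  rewrite mulf_neq0 ?oppr_eq0 // paddr_eq0 ?sqr_ge0 // !sqrf_eq0 negb_and.
  case/orP: ad => [|->//]; rewrite -addr_eq0 => aa.
  by apply/orP; right; apply: contraNneq aa => ->; rewrite addr0.
have [t [e [e2 te]]] := signed_fourth_root_inv q0.
pose Q : 'M[R]_(2, n) :=
  \matrix_(i < 2) (if i == 0 then t *: u else (e * t) *: v).
have Q0 : row 0 Q = t *: u by rewrite rowK.
have Q1 : row 1 Q = (e * t) *: v by rewrite rowK.
have bZ B r x r' y : b B (r *: x) (r' *: y) = r * r' * b B x y.
  by rewrite /b linearZ /= -!scalemxAl -scalemxAr !mxE mulrA.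
have ord2 (i : 'I_2) : i = 0 \/ i = 1.
  by case: i => [[|[|//]]] ilt; [left|right]; apply/val_inj.
have QB B : B^T = B -> b B v v = - b B u u -> Q *m B *m Q^T =
    sym_traceless (t ^+ 2 * b B u u) (e * t ^+ 2 * b B u v).
  move=> Bs Bvv; apply/matrixP=> i j; rewrite mulmx_congrE [RHS]mxE -/(b B _ _).
  have [->|->] := ord2 i; have [->|->] := ord2 j; rewrite ?Q0 ?Q1 bZ /= ?Bvv.
  - by rewrite expr2.
  - by rewrite expr2 mulrCA mulrA.
  - by rewrite (bsym _ v) // expr2 mulrA.
  - by rewrite mulrACA -!expr2 e2 mul1r mulrN.
(* The matrix of [S] in the basis [t *: u], [(e * t) *: v]; [e] is its own inverse. *)
exists Q, (\matrix_(i, j)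
  if i == j then mu else if i == 0 then - nu * e else nu * e).
split.
  apply/row_matrixP=> i; rewrite !row_mul [RHS]mulmx_sum_row.
  rewrite !big_ord_recl big_ord0 addr0 !mxE.
  have -> : lift ord0 ord0 = 1 :> 'I_2 by apply/val_inj.
  have [->|->] := ord2 i; rewrite ?Q0 ?Q1 -?scalemxAl ?uS ?vS /= !scalerA.
    rewrite scalerBr !scalerA; congr (_ *: _ + _); rewrite 1?mulrC // -scaleNr.
    by congr (_ *: _); rewrite mulNr mulNr -mulrA (mulrA e) -expr2 e2;
    rewrite mul1r mulrC.
  rewrite scalerDr !scalerA; congr (_ *: _ + _ *: _); ring.
constructor; exists (t ^+ 2 * a), (e * t ^+ 2 * d),
  (t ^+ 2 * (mu * a - nu * d)), (e * t ^+ 2 * (mu * d + nu * a)).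
have q1 : t ^+ 2 * (mu * a - nu * d) * (e * t ^+ 2 * d) -
    t ^+ 2 * a * (e * t ^+ 2 * (mu * d + nu * a)) = 1.
  by rewrite -te; ring.
have cE : b A v v = - a by [].
split=> //; split; last by rewrite q1.
  by apply: QB.
rewrite QB //; first by congr sym_traceless;
  rewrite ?buS ?bvS ?cE ?(bsym A v u) // /a /d; ring.
by rewrite buS bvS cE (bsym A v u) // -/a -/d; ring.
Qed.

Lemma standard_block_exists (R : realType) n (A S : 'M[R]_n) :
    (0 < n)%N -> A \in unitmx -> S \in unitmx ->
    A^T = A -> (S *m A)^T = S *m A ->
    no_jordan_chain (map_mx (real_complex R) S) ->
  exists (k : nat) (Q : 'M_(k, n)) (M : 'M_k), Q *m S = M *m Q /\
    typeI_or_standard_typeII (Q *m A *m Q^T) (Q *m (S *m A) *m Q^T).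
Proof.
move=> n0 Au Su As SAs njS.
have [[mu nu] /eigenvalueP[z zS z0]] :=
  eigenvalue_closed (map_mx (real_complex R) S) n0.
have [nu0|nu0] := eqVneq nu 0.
  have [uS vS] := complex_eigenvectorP zS.
  (* For a real eigenvalue, the real and imaginary parts of [z] both satisfy the eigenvector
     equation, and one of them is non-zero. *)
  have [x xS x0] : exists2 x : 'rV_n, x *m S = mu *: x & x != 0.
    move: uS vS; rewrite nu0 !scale0r subr0 add0r => uS vS.
    have [u0|u0] := eqVneq (map_mx (@complex.Re R) z) 0; last first.
      by exists (map_mx (@complex.Re R) z).
    exists (map_mx (@complex.Im R) z) => //.
    apply: contra_neq z0 => v0; apply/rowP=> j.
    have := congr1 (fun w : 'rV_n => w 0 j) u0.
    have := congr1 (fun w : 'rV_n => w 0 j) v0.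
    by rewrite !mxE; case: (z 0 j) => r i /= -> ->.
  have [||y yS yy] := anisotropic_eigenvector _ Au As SAs _ xS x0.
  - by rewrite pnatr_eq0.
  - exact: no_jordan_chain_map njS.
  exists 1%N, y, mu%:M; split; first by rewrite mul_scalar_mx.
  exact: real_eigen_block yS yy.
set f := real_complex R.
have [||||y yS yy] := anisotropic_eigenvector _ _ _ _ njS zS z0
  (A := map_mx f A).
- by rewrite pnatr_eq0.
- by rewrite map_unitmx.
- by rewrite map_trmx As.
- by rewrite -map_mxM map_trmx SAs.
have [uS vS] := complex_eigenvectorP yS.
have [|Q [M [QS good]]] := complex_eigen_block As SAs nu0 uS vS.
  rewrite -negb_and; apply: contraNN yy => /andP[/eqP uv /eqP d0].
  apply/eqP/matrixP=> i j; rewrite !ord1 complex_formE // uv d0 subrr mul0rn.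
  by rewrite mxE.
by exists 2%N, Q, M.
Qed.

(** * Orthogonal splitting and induction *)

(** Nested binary blocks keep the sizes as literal sums [k + n], so the induction builds them
    without casts. *)
Inductive block_diagonal (R : realType) :
    forall n, 'M[R]_n -> 'M[R]_n -> Prop :=
| Block_nil : @block_diagonal R 0 0 0
| Block_cons k n (C D : 'M_k) (X Y : 'M_n) :
    typeI_or_standard_typeII C D -> block_diagonal X Y ->
    @block_diagonal R (k + n) (block_mx C 0 0 X) (block_mx D 0 0 Y).

(** A Type II block has determinant [- (a1 ^+ 2 + b1 ^+ 2)], and [a1 = b1 = 0] would contradict
    positivity. *)
Lemma standard_block_unit (R : realType) k (C D : 'M[R]_k) :
  typeI_or_standard_typeII C D -> C \in unitmx.
Proof.
case=> {k C D}[c d [c0 _]|C D [a1 [b1 [a2 [b2 [[-> _ pos] _]]]]]].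
  by rewrite unitmxE det_scalar1 unitfE.
rewrite unitmxE unitfE (expand_det_row _ ord0) !big_ord_recl big_ord0.
rewrite /cofactor !det_mx11 !mxE /=; apply: contraTneq pos => e.
have /eqP : a1 ^+ 2 + b1 ^+ 2 = 0 by move: e; lra.
rewrite paddr_eq0 ?sqr_ge0 // !sqrf_eq0 => /andP[/eqP-> /eqP->].
by rewrite mulr0 mul0r subrr ltxx.
Qed.

Lemma standard_block_gt0 (R : realType) k (C D : 'M[R]_k) :
  typeI_or_standard_typeII C D -> (0 < k)%N.
Proof. by case. Qed.

Lemma block_diagonal_unit (R : realType) n (X Y : 'M[R]_n) :
  block_diagonal X Y -> X \in unitmx.
Proof.
elim=> {n X Y}[|k n C D X Y good _ Xu].
  by rewrite unitmxE det_mx00 unitr1.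
by rewrite unitmxE det_ublock unitrM -!unitmxE (standard_block_unit good).
Qed.

Lemma orthogonal_complement_reduction (F : fieldType) n k (A S : 'M[F]_n)
    (Q : 'M_(k, n)) (M : 'M_k) :
    A \in unitmx -> S \in unitmx -> A^T = A -> (S *m A)^T = S *m A ->
    Q *m S = M *m Q -> Q *m A *m Q^T \in unitmx ->
  exists r (K : 'M_(r, n)) (T : 'M_r), [/\ (k + r = n)%N, row_free K,
    K *m S = T *m K, K *m A *m Q^T = 0 &
    (K *m A *m K^T \in unitmx) && (T \in unitmx)].
Proof.
move=> Au Su As SAs QS Gu; pose N := kermx (A *m Q^T).
pose K := row_base N; have Kfree : row_free K := row_base_free N.
have KAQ : K *m A *m Q^T = 0.
  by rewrite -mulmxA; apply/sub_kermxP; rewrite eq_row_base.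
have subK m (W : 'M_(m, n)) : W *m A *m Q^T = 0 -> exists D, W = D *m K.
  by rewrite -mulmxA => W0; apply/submxP; rewrite eq_row_base; apply/sub_kermxP.
have rQ : \rank (A *m Q^T) = k.
  apply/eqP; rewrite eqn_leq rank_leq_col -{1}(mxrank_unit Gu) -mulmxA.
  exact: mxrankM_maxr.
(* Self-adjointness moves [S] onto [Q], whose row span is invariant, so [K *m S] stays orthogonal to
   [Q]. *)
have [T KS] : exists T, K *m S = T *m K.
  apply: subK; rewrite -[_ *m S *m A]mulmxA -SAs trmx_mul As mulmxA -mulmxA.
  by rewrite -trmx_mul QS trmx_mul mulmxA KAQ mul0mx.
clearbody K; exists (\rank N), K, T; split=> //; last (apply/andP; split).
- by rewrite mxrank_ker rQ subnKC // -rQ rank_leq_row.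
- rewrite -row_free_unit -kermx_eq0; apply/eqP.
  set x := kermx _; have xK : x *m K *m A *m K^T = 0.
    by rewrite -!mulmxA mulmxA mulmx_ker.
  (* [U] is the [A]-orthogonal projection onto the complement. As [x *m K] is orthogonal to [Q],
     pairing it with [U] is pairing it with the whole space. *)
  pose U := 1%:M - A *m Q^T *m invmx (Q *m A *m Q^T) *m Q.
  have [W UE] : exists W, U = W *m K.
    apply: subK; rewrite -mulmxA mulmxBl mul1mx.
    apply/eqP; rewrite subr_eq0; apply/eqP.
    by rewrite -!mulmxA (mulmxA Q A) mulVmx // mulmx1.
  have : x *m K *m A *m U^T = 0 by rewrite UE trmx_mul mulmxA xK mul0mx.
  rewrite linearB /= trmx1 trmx_mul trmx_mul !mulmxA mulmxBr mulmx1 !mulmxA.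
  rewrite -(mulmxA x K) -(mulmxA x (K *m A)) KAQ mulmx0 !mul0mx subr0.
  move/(congr1 (mulmx^~ (invmx A))); rewrite !mulmxA mulmxK // mul0mx => xK0.
  by apply: (row_free_inj Kfree); rewrite mul0mx.
- rewrite -row_free_unit -kermx_eq0; apply/eqP.
  apply: (row_free_inj Kfree); apply: (can_inj (mulmxK Su)).
  by rewrite -mulmxA KS mulmxA mulmx_ker !mul0mx.
Qed.

Lemma simultaneous_block_diagonalization (R : realType) n (A S : 'M[R]_n) :
    A \in unitmx -> S \in unitmx -> A^T = A -> (S *m A)^T = S *m A ->
    no_jordan_chain (map_mx (real_complex R) S) ->
  exists2 P : 'M[R]_n, P \in unitmx &
    block_diagonal (P *m A *m P^T) (P *m (S *m A) *m P^T).
Proof.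
(* Since [k + r = n] holds only propositionally, [P] gets its own row count [m]; its invertibility
   is read off the non-singular block diagonal matrix. *)
suff H : A \in unitmx -> S \in unitmx -> A^T = A -> (S *m A)^T = S *m A ->
    no_jordan_chain (map_mx (real_complex R) S) ->
    exists m (P : 'M[R]_(m, n)), m = n /\
    block_diagonal (P *m A *m P^T) (P *m (S *m A) *m P^T).
  move=> Au Su As SAs njS; have [m [P [e bd]]] := H Au Su As SAs njS.
  case: _ / e A S Au Su As SAs njS {H} P bd => A S Au _ _ _ _ P bd.
  exists P => //; move: (block_diagonal_unit bd).
  by rewrite !unitmx_mul => /andP[/andP[]].
have [N] := ubnP n; elim: N => // N IHN in n A S *.
rewrite ltnS => nN Au Su As SAs njS.
have [n0|n0] := posnP n.
  exists 0%N, 0; split=> //.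
  have e0 (M : 'M[R]_0) : M = 0 by apply/matrixP=> [[]].
  by rewrite (e0 (_ *m A *m _)) (e0 (_ *m (S *m A) *m _)); constructor.
have [k [Q [M [QS good]]]] := standard_block_exists n0 Au Su As SAs njS.
have [r [K [T [kr Kfree KS KAQ /andP[Ku Tu]]]]] :=
  orthogonal_complement_reduction Au Su As SAs QS (standard_block_unit good).
(* The restricted operator and form are again related as [S] and [A], so the induction hypothesis
   applies to them. *)
have TK : T *m (K *m A *m K^T) = K *m (S *m A) *m K^T.
  by rewrite !mulmxA -KS.
have [||||m [P [mr bd]]] := IHN r (K *m A *m K^T) T _ Ku Tu.
- by apply: leq_trans nN; rewrite -kr -add1n leq_add2r;
  rewrite (standard_block_gt0 good).
- by rewrite !trmx_mul trmxK As mulmxA.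
- by rewrite TK trmx_mul trmxK trmx_mul SAs mulmxA.
- apply: (no_jordan_chain_restrict (K := map_mx (real_complex R) K)) njS.
    by rewrite row_free_map.
  by rewrite -!map_mxM KS.
exists (k + m)%N, (col_mx Q (P *m K)); split; first by rewrite mr.
have QAK : Q *m A *m K^T = 0.
  by apply: trmx_inj; rewrite !trmx_mul trmxK As mulmxA KAQ trmx0.
have block B : Q *m B *m K^T = 0 -> K *m B *m Q^T = 0 ->
    col_mx Q (P *m K) *m B *m (col_mx Q (P *m K))^T =
    block_mx (Q *m B *m Q^T) 0 0 (P *m (K *m B *m K^T) *m P^T).
  move=> QBK KBQ; rewrite tr_col_mx mul_col_mx mul_col_row trmx_mul.
  congr block_mx; rewrite ?mulmxA ?QBK ?mul0mx //.
  by rewrite -!mulmxA (mulmxA K) KBQ mulmx0.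
have QSAK : Q *m (S *m A) *m K^T = 0.
  by rewrite mulmxA QS -2!mulmxA (mulmxA Q) QAK mulmx0.
have KSAQ : K *m (S *m A) *m Q^T = 0.
  by apply: trmx_inj; rewrite !trmx_mul trmxK -trmx_mul SAs mulmxA QSAK trmx0.
by rewrite !block // -TK; constructor.
Qed.

(** * Indexed families of blocks and conclusion *)

Definition block_pair (R : realType) := {k : nat & ('M[R]_k * 'M[R]_k)%type}.

(* Each [nth] of [b :: s] at [lift ord0 i] reduces to the [nth] of [s] at [i],
   which makes the dependent types of [mxdiag_recl] agree by conversion. *)
Lemma block_diagonal_mxdiag (R : realType) n (X Y : 'M[R]_n) :
  block_diagonal X Y ->
  exists (s : seq (block_pair R)) (b0 : block_pair R)
    (e : (\sum_(i < size s) tag (nth b0 s i))%N = n),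
    [/\ (size s <= n)%N,
        X = castmx (e, e) (\mxdiag_(i < size s) (tagged (nth b0 s i)).1),
        Y = castmx (e, e) (\mxdiag_(i < size s) (tagged (nth b0 s i)).2) &
        forall i : 'I_(size s), typeI_or_standard_typeII
          (tagged (nth b0 s i)).1 (tagged (nth b0 s i)).2].
Proof.
elim=> {n X Y}[|k n C D X Y good _ [s [b0 [e [sn XE YE goods]]]]].
  exists [::], (existT _ 0%N (0, 0) : block_pair R), (big_ord0 _ _ _ _).
  by split=> //; [apply/matrixP=> [[]]|apply/matrixP=> [[]]|case].
pose b : block_pair R := existT _ k (C, D).
have e' : (\sum_(i < size (b :: s)) tag (nth b0 (b :: s) i))%N = (k + n)%N.
  by rewrite big_ord_recl /= -e.
exists (b :: s), b0, e'; split.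
- by rewrite /= -add1n leq_add // (standard_block_gt0 good).
- rewrite mxdiag_recl castmx_comp XE /=.
  (* The casts merge; once [e] is eliminated, the remaining equation has equal sides and is [erefl]
     by uniqueness of identity proofs on [nat]. *)
  move: (etrans _ _); case: _ / e {XE YE e'} => e'.
  by rewrite castmx_id (eq_irrelevance e' erefl) castmx_id.
- rewrite mxdiag_recl castmx_comp YE /=.
  move: (etrans _ _); case: _ / e {XE YE e'} => e'.
  by rewrite castmx_id (eq_irrelevance e' erefl) castmx_id.
- by case=> [[|i]] i_lt //=; apply: (goods (Ordinal (i_lt : (i < size s)%N))).
Qed.

Theorem theoremA1 (R : realType) (n : nat) (A1 A2 : 'M[R]_n)
    (n_gt0 : (0 < n)%N)
    (A1_unit : A1 \in unitmx) (A2_unit : A2 \in unitmx)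
    (A1_sym : A1^T = A1) (A2_sym : A2^T = A2)
    (diagC : diagonalizable (map_mx (real_complex R) (invmx A1 *m A2))) :
  exists2 P : 'M[R]_n, P \in unitmx &
  exists (m : nat) (p : 'I_m -> nat) (C D : forall i : 'I_m, 'M[R]_(p i))
         (sum_p : (\sum_(i < m) p i)%N = n),
    [/\ (1 <= m <= n)%N,
        P^T *m A1 *m P = castmx (sum_p, sum_p) (\mxdiag_(i < m) C i),
        P^T *m A2 *m P = castmx (sum_p, sum_p) (\mxdiag_(i < m) D i)
      & forall i : 'I_m, typeI_or_standard_typeII (C i) (D i)].
Proof.
pose S := A2 *m invmx A1.
have SA : S *m A1 = A2 by rewrite mulmxKV.
have njS : no_jordan_chain (map_mx (real_complex R) S).
  have -> : S = (invmx A1 *m A2)^T by rewrite trmx_mul trmx_inv A1_sym A2_sym.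
  by rewrite -map_trmx; apply: diagonalizable_no_jordan_chain_tr.
have Su : S \in unitmx by rewrite unitmx_mul A2_unit unitmx_inv.
have [|P Pu] := simultaneous_block_diagonalization A1_unit Su A1_sym _ njS.
  by rewrite SA.
rewrite SA => /block_diagonal_mxdiag[s [b0 [e [sn A1E A2E good]]]].
(* The new basis consists of the rows of [P], whereas the statement takes columns. *)
exists P^T; first by rewrite unitmx_tr.
exists (size s), (fun i => tag (nth b0 s i)),
  (fun i => (tagged (nth b0 s i)).1),
  (fun i => (tagged (nth b0 s i)).2), e; rewrite trmxK; split=> //.
rewrite sn andbT lt0n; apply: contraTneq n_gt0 => s0.
by rewrite -e big1 // => -[i i_lt]; move: (i_lt); rewrite s0.
Qed.
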